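(* Let $x_1,\dots,x_n$ ($n\ge2$) be a finite sequence of points (not necessarily vertices) in a locally finite geometric tree $T$. Then $$\mathrm{im}(u_{x_1,x_n})\subseteq\bigcup_{i=1}^{n-1}\mathrm{im}(u_{x_i,x_{i+1}}).$$
   Context: A geometric tree is a contractible simplicial $1$-complex equipped with the canonical path metric in which each edge is isometric to the unit interval; it is locally finite if each vertex has finitely many edges attached. Locally finite geometric trees are uniquely geodesic; $u_{x,x'}:[0,d_T(x,x')]\to T$ denotes the unique isometric embedding with $u_{x,x'}(0)=x$ and $u_{x,x'}(d_T(x,x'))=x'$. *)

(* Defs.v *)
From HB Require Import structures.
From mathcomp Require Import all_boot all_order all_algebra finmap.
From mathcomp Require Import all_classical all_reals all_analysis.

Set Implicit Arguments.
Unset Strict Implicit.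
Unset Printing Implicit Defensive.

Import Order.TTheory GRing.Theory Num.Theory numFieldNormedType.Exports.
Local Open Scope classical_set_scope.
Local Open Scope ring_scope.

Record simplicial1 (V : choiceType) := Simplicial1 {
  simplex : set {fset V};
  simplex_neq0 : forall A, simplex A -> A != fset0;
  simplex_vertex : forall v, simplex [fset v]%fset;
  simplex_face : forall A B,
    simplex A -> (B `<=` A)%fset -> B != fset0 -> simplex B;
  simplex_dim : forall A, simplex A -> (#|` A| <= 2)%N }.

(* A simplex with two elements is an edge, so finitely many simplices at each
   vertex is the same as finitely many edges at each vertex. *)
Definition locally_finite (V : choiceType) (K : simplicial1 V) :=
  forall v : V, finite_set [set A | simplex K A /\ v \in A].

(* p gives the barycentric coordinates of a point of the closed simplex A. *)
Definition in_simplex (R : realType) (V : choiceType) (A : {fset V})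
    (p : V -> R) :=
  [/\ forall v, 0 <= p v,
      forall v, v \notin A -> p v = 0
    & \sum_(v <- A) p v = 1].

Record realization (R : realType) (V : choiceType) (K : simplicial1 V) :=
  Point {
    bary :> V -> R;
    baryP : exists2 A, simplex K A & in_simplex A bary }.

Section Realization.
Context {R : realType} {V : choiceType} {K : simplicial1 V}.
Local Notation T := (realization R K).

HB.instance Definition _ := gen_eqMixin T.
HB.instance Definition _ := gen_choiceMixin T.

(* Only meant for p and q in a common closed simplex.  On the edge {v, w},
   parametrised by t |-> (1 - t) v + t w, half the l1 distance of the
   barycentric coordinates is |t - t'|, so that the edge is isometric to the
   unit interval.  The sum has finite support. *)
Definition segment_length (p q : T) : R :=
  2^-1 * \sum_(v \in [set: V]) `|p v - q v|.

(* The topology of the complex: U is open iff its trace on every closed simplex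
   is open in that simplex. *)
Definition complex_open (U : set T) :=
  forall A, simplex K A -> forall p : T, in_simplex A p -> U p ->
  exists2 e : R, 0 < e &
    forall q : T, in_simplex A q -> segment_length p q < e -> U q.

Lemma complex_openT : complex_open setT.
Proof. by move=> A KA p Ap _; exists 1. Qed.

Lemma complex_openI : setI_closed complex_open.
Proof.
move=> U W oU oW A KA p Ap [Up Wp].
have [e e0 eU] := oU A KA p Ap Up; have [f f0 fW] := oW A KA p Ap Wp.
exists (Num.min e f); first by rewrite lt_min e0 f0.
by move=> q Aq; rewrite lt_min => /andP[qe qf]; split; [exact: eU|exact: fW].
Qed.

Lemma complex_open_bigU (I : Type) (f : I -> set T) :
  (forall i, complex_open (f i)) -> complex_open (\bigcup_i f i).
Proof.
move=> of_ A KA p Ap [i _ fip]; have [e e0 ef] := of_ i A KA p Ap fip.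
by exists e => // q Aq qe; exists i => //; exact: ef.
Qed.

HB.instance Definition _ := isOpenTopological.Build T
  complex_openT complex_openI complex_open_bigU.

Definition same_simplex (p q : T) :=
  exists A, [/\ simplex K A, in_simplex A p & in_simplex A q].

(* A string is a finite sequence of points in which any two consecutive points
   lie in a common closed simplex, i.e. a piecewise linear path. *)
Fixpoint is_string (p : T) (s : seq T) : Prop :=
  if s is q :: s' then same_simplex p q /\ is_string q s' else True.

Fixpoint string_length (p : T) (s : seq T) : R :=
  if s is q :: s' then segment_length p q + string_length q s' else 0.

(* The path metric.  Any two points of a connected complex are joined by a
   string; on a disconnected one, inf set0 = 0 would be a junk value. *)
Definition path_dist (p q : T) : R :=
  inf [set string_length p s | s in [set s | is_string p s /\ last p s = q]].

Definition isometric_path (p q : T) (u : R -> T) :=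
  [/\ u 0 = p, u (path_dist p q) = q
    & {in `[0, path_dist p q] &, forall s t, path_dist (u s) (u t) = `|s - t|}].

(* u_{p,q}, chosen among the isometric embeddings of [0, d(p,q)] joining p to
   q; its values outside [0, d(p,q)] are arbitrary.  The default cst p is never
   reached in a locally finite geometric tree, which is uniquely geodesic. *)
Definition geod (p q : T) : R -> T := xget (cst p) (isometric_path p q).

Definition im_geod (p q : T) : set T := geod p q @` `[0, path_dist p q].

End Realization.

Definition contractible (R : realType) (X : topologicalType) :=
  exists (x0 : X) (H : X * R -> X),
    [/\ {within [set: X] `*` `[0, 1], continuous H},
        forall x, H (x, 0) = x
      & forall x, H (x, 1) = x0].

(* For a locally finite K the topology of the complex is also the topology of
   the path metric. *)
Definition geometric_tree (R : realType) (V : choiceType)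
    (K : simplicial1 V) := contractible R (realization R K).

(* Main.v *)
(** A bump function on a small interval around an interior point p of an edge,
    read modulo 1, collapses the rest of the complex to a point of the circle.
    As the complex is contractible, this circle-valued map lifts to a real
    function on any compact set.  If a geodesic from x to z crosses p, the lift
    changes by one along it, whereas along a path avoiding p it stays between two
    consecutive half-integers; so every path from x to z goes through p.  Hence
    each point of the geodesic from x to z lies on the one from x to y or on the
    one from y to z: a vertex in neither would, these being closed, have interior
    points of edges near it in neither.  The theorem follows by induction on n.

    Geodesics exist because a shortest string may be sought among those that
    travel from vertex to vertex along full edges, whose lengths form a discrete
    set. *)

Require Import Defs.
From mathcomp Require Import all_boot all_order all_algebra finmap.
From mathcomp Require Import all_classical all_reals all_analysis.
From mathcomp Require Import ring lra.

Set Implicit Arguments.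
Unset Strict Implicit.
Unset Printing Implicit Defensive.

Import Order.TTheory GRing.Theory Num.Theory numFieldNormedType.Exports.
Local Open Scope classical_set_scope.
Local Open Scope ring_scope.

(** * Segments of a 1-dimensional complex *)

Section Segments.
Context {R : realType} {V : choiceType} {K : simplicial1 V}.
Local Notation T := (realization R K).

Implicit Types (p q r : T) (A B : {fset V}) (v w : V).

(** The case [w' = w] covers the single vertices, so that vertices and edges are treated
    together. *)
Lemma simplex_pair A w :
  simplex K A -> w \in A -> exists2 w', w' \in A & A = [fset w; w']%fset.
Proof.
move=> KA wA; have [[w' w'A w'w]|none] := pselect (exists2 w', w' \in A & w' != w).
  exists w' => //; apply/eqP; rewrite eq_sym eqEfcard; apply/andP; split.
    by apply/fsubsetP => v; rewrite !inE => /orP[]/eqP->.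
  by rewrite cardfs2 eq_sym w'w; exact: simplex_dim KA.
exists w => //; apply/fsetP => v; rewrite !inE orbb; apply/idP/eqP => [vA|->//].
by apply/eqP; apply: contraPT none => vw; apply; exists v.
Qed.

Lemma realization_eq p q : (forall v, p v = q v) -> p = q.
Proof.
case: p q => [f Kf] [g Kg] /= /funext fg; subst g.
by rewrite (Prop_irrelevance Kf Kg).
Qed.

Lemma in_simplex_pair (f : V -> R) v w :
  in_simplex [fset v; w]%fset f -> v != w -> f v + f w = 1.
Proof.
by case=> _ _ + vw; rewrite big_fsetU1 ?big_seq_fset1 ?inE.
Qed.

Lemma bary_le1 p v : p v <= 1.
Proof.
case: (baryP p) => A KA pA; have [vA|vA] := boolP (v \in A); last first.
  by case: pA => _ -> //; rewrite ler01.
have [w wA Aw] := simplex_pair KA vA; rewrite Aw in pA.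
have [p0 _ ps] := pA; have [vw|/(in_simplex_pair pA)] := eqVneq v w.
  by move: ps; rewrite -vw fsetUid big_seq_fset1 => ->.
by have := p0 w; lra.
Qed.

Lemma bary_ge0 p v : 0 <= p v.
Proof. by case: (baryP p) => A _ []. Qed.

Lemma simplex_exists p : exists2 A, simplex K A & in_simplex A p.
Proof. exact: baryP. Qed.

Lemma bary_gt0_mem p v A : in_simplex A p -> 0 < p v -> v \in A.
Proof.
by move=> [_ pA _] pv; have [//|/pA p0] := boolP (v \in A); rewrite p0 ltxx in pv.
Qed.

(** The two coordinates on an edge sum to 1, so they change by opposite amounts and half the l1
    distance is the change of either one. *)
Lemma segment_length_coord A p q w : simplex K A -> in_simplex A p ->
  in_simplex A q -> w \in A -> segment_length p q = `|p w - q w|.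
Proof.
move=> KA pA qA wA; rewrite /segment_length.
have -> : \sum_(v \in [set: V]) `|p v - q v| = \sum_(v <- A) `|p v - q v|.
  rewrite (fsbigE A) ?fset_uniq//; first by apply: eq_bigl => v; rewrite in_setT.
  by case: pA qA => _ pA _ [_ qA _] v _ vA; rewrite pA// qA// subrr normr0.
have [w' w'A Aw] := simplex_pair KA wA; rewrite Aw in pA qA *.
have [ww'|ww'] := eqVneq w w'.
  case: pA qA => _ _ + [_ _ +]; rewrite -ww' fsetUid !big_seq_fset1 => -> ->.
  by rewrite subrr normr0 mulr0.
rewrite big_fsetU1 ?inE// big_seq_fset1 /=.
have := in_simplex_pair pA ww'; have := in_simplex_pair qA ww' => eq ep.
have -> : p w' - q w' = - (p w - q w) by lra.
by rewrite normrN; field.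
Qed.

Lemma in_simplex_ext A p q w : simplex K A -> in_simplex A p ->
  in_simplex A q -> w \in A -> p w = q w -> p = q.
Proof.
move=> KA pA qA wA pqw; apply: realization_eq => v.
have [vA|vA] := boolP (v \in A); last by case: pA qA => _ -> // _ [_ ->].
apply/eqP; rewrite -subr_eq0 -normr_eq0 -(segment_length_coord KA pA qA vA).
by rewrite (segment_length_coord KA pA qA wA) pqw subrr normr0.
Qed.

Lemma simplex_mem A : simplex K A -> exists w, w \in A.
Proof. by move=> /simplex_neq0 /fset0Pn. Qed.

Lemma segment_length_ge0 p q : 0 <= segment_length p q.
Proof. by rewrite mulr_ge0 ?invr_ge0// sumr_ge0. Qed.

Lemma segment_lengthC p q : segment_length p q = segment_length q p.
Proof.
by rewrite /segment_length; congr (_ * _); apply: eq_fsbigr => v; rewrite distrC.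
Qed.

Lemma segment_lengthxx p : segment_length p p = 0.
Proof.
have [A KA pA] := simplex_exists p; have [w wA] := simplex_mem KA.
by rewrite (segment_length_coord KA pA pA wA) subrr normr0.
Qed.

Lemma segment_length_triangle A p q r : simplex K A -> in_simplex A p ->
  in_simplex A q -> in_simplex A r ->
  segment_length p r <= segment_length p q + segment_length q r.
Proof.
move=> KA pA qA rA; have [w wA] := simplex_mem KA.
by rewrite !(segment_length_coord KA _ _ wA)//; exact: ler_distD.
Qed.

Lemma segment_length_le1 p q : same_simplex p q -> segment_length p q <= 1.
Proof.
move=> [A [KA pA qA]]; have [w wA] := simplex_mem KA.
rewrite (segment_length_coord KA pA qA wA) ler_norml.
have := bary_ge0 p w; have := bary_ge0 q w.
by have := bary_le1 p w; have := bary_le1 q w; lra.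
Qed.

Lemma segment_length_eq0 p q :
  same_simplex p q -> segment_length p q = 0 -> p = q.
Proof.
move=> [A [KA pA qA]]; have [w wA] := simplex_mem KA.
rewrite (segment_length_coord KA pA qA wA) => /eqP; rewrite normr_eq0 subr_eq0.
by move=> /eqP; exact: (in_simplex_ext KA pA qA wA).
Qed.

Lemma same_simplexC p q : same_simplex p q -> same_simplex q p.
Proof. by move=> [A [? ? ?]]; exists A. Qed.

Lemma same_simplexxx p : same_simplex p p.
Proof. by have [A KA pA] := simplex_exists p; exists A. Qed.

Lemma vertex_subproof v :
  exists2 A, simplex K A & in_simplex A (fun w => (w == v)%:R : R).
Proof.
exists [fset v]%fset; first exact: simplex_vertex.
split=> [w|w|]; first by rewrite ler0n.
  by rewrite inE => /negbTE ->.
by rewrite big_seq_fset1 eqxx.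
Qed.
Definition vertex v : T := Point (vertex_subproof v).

Lemma vertexE v w : vertex v w = (w == v)%:R. Proof. by []. Qed.

Lemma in_simplex_vertex A v : simplex K A -> v \in A -> in_simplex A (vertex v).
Proof.
move=> KA vA; split=> [w|w wA|]; first exact: bary_ge0.
  by rewrite vertexE; case: eqP wA => // ->; rewrite vA.
rewrite (big_fsetD1 v)//= eqxx big1_fset ?addr0//.
by move=> w; rewrite !inE => /andP[/negbTE->].
Qed.

Lemma segment_length_vertex A p v : simplex K A -> in_simplex A p -> v \in A ->
  segment_length p (vertex v) = 1 - p v.
Proof.
move=> KA pA vA.
rewrite (segment_length_coord KA pA (in_simplex_vertex KA vA) vA) vertexE eqxx.
by rewrite distrC ger0_norm// subr_ge0 bary_le1.
Qed.

Lemma eq_vertex p v : p v = 1 -> p = vertex v.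
Proof.
move=> pv; have [A KA pA] := simplex_exists p.
have vA : v \in A by apply: bary_gt0_mem pA _; rewrite pv.
apply: (in_simplex_ext KA pA (in_simplex_vertex KA vA) vA).
by rewrite pv vertexE eqxx.
Qed.

Lemma bary_support A p : simplex K A -> in_simplex A p -> exists2 v, v \in A & 0 < p v.
Proof.
move=> KA pA; have [w wA] := simplex_mem KA.
have [w' w'A Aw] := simplex_pair KA wA.
have [pw|pw] := ltP 0 (p w); first by exists w.
have pw0 : p w = 0 by apply/eqP; rewrite eq_le pw bary_ge0.
exists w' => //; move: pA; rewrite Aw => pA.
have [ww'|/(in_simplex_pair pA)] := eqVneq w w'; last by lra.
by move: pA => [_ _]; rewrite -ww' fsetUid big_seq_fset1; lra.
Qed.

Lemma bary_lt1_pair A p v : simplex K A -> in_simplex A p -> v \in A ->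
  p v < 1 -> exists w, [/\ w \in A, A = [fset v; w]%fset, v != w & p w = 1 - p v].
Proof.
move=> KA pA vA pv; have [w wA Aw] := simplex_pair KA vA.
exists w; rewrite Aw in pA; have [vw|vw] := eqVneq v w.
  by exfalso; move: pA pv => [_ _]; rewrite -vw fsetUid big_seq_fset1; lra.
by split=> //; have := in_simplex_pair pA vw; lra.
Qed.

(** A point with a coordinate strictly between 0 and 1 has both ends of its edge in its support, and
    any simplex containing the point contains that support. *)
Lemma two_simplices_vertex A B p : simplex K A -> simplex K B ->
  in_simplex A p -> in_simplex B p ->
  A = B \/ exists v, [/\ v \in A, v \in B & p = vertex v].
Proof.
move=> KA KB pA pB; have [v vA pv] := bary_support KA pA.
have vB : v \in B by exact: bary_gt0_mem pB pv.
have [pv1|pv1] := ltP (p v) 1; last first.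
  right; exists v; split=> //; apply: eq_vertex; apply/eqP.
  by rewrite eq_le pv1 bary_le1.
have [w [wA Aw vw pw]] := bary_lt1_pair KA pA vA pv1.
have [w' [w'B Bw vw' pw']] := bary_lt1_pair KB pB vB pv1.
left; rewrite Aw Bw; congr [fset _; _]%fset.
have : w \in B by apply: bary_gt0_mem pB _; lra.
by rewrite Bw !inE eq_sym (negbTE vw) => /eqP.
Qed.

End Segments.

(** * Strings and the path metric *)

Lemma finite_set_min {R : realType} (S : set R) :
  finite_set S -> S !=set0 -> exists2 m, S m & lbound S m.
Proof.
move=> /finite_seqP[s ->] {S}; elim: s => [[x]//|a s IH _].
have [->|s0] := eqVneq s [::].
  by exists a => [|y] /=; rewrite inE// => /eqP ->.
have [] := IH; first by case: s {IH} s0 => // b s _; exists b; rewrite /= inE eqxx.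
move=> m ms ml; exists (Num.min a m).
  by rewrite /= inE; case: leP; rewrite ?eqxx// ms orbT.
by move=> y /=; rewrite inE ge_min => /orP[/eqP->|/ml->]; rewrite ?lexx ?orbT.
Qed.

Section Strings.
Context {R : realType} {V : choiceType} {K : simplicial1 V}.
Local Notation T := (realization R K).

Implicit Types (p q r : T) (A B : {fset V}) (v w : V) (l : R).

Definition joined p q l :=
  exists s, [/\ is_string p s, last p s = q & string_length p s = l].

Lemma joinedxx p : joined p p 0. Proof. by exists [::]. Qed.

Lemma joined_cons p q r l : same_simplex p q -> joined q r l ->
  joined p r (segment_length p q + l).
Proof. by move=> pq [s [qs <- <-]]; exists (q :: s). Qed.

Lemma joined_same p q : same_simplex p q -> joined p q (segment_length p q).
Proof. by move=> pq; rewrite -[X in joined _ _ X]addr0; exact: joined_cons (joinedxx q). Qed.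

Lemma joined_ind (P : T -> T -> R -> Prop) :
  (forall p, P p p 0) ->
  (forall p q r l, same_simplex p q -> joined q r l -> P q r l ->
    P p r (segment_length p q + l)) ->
  forall p q l, joined p q l -> P p q l.
Proof.
move=> P0 PS p q l [s [ps <- <-]]; elim: s p ps => [|r s IH] p //= [pr rs].
by apply: PS (IH _ rs) => //; exists s.
Qed.

Lemma joined_cat p q r l l' : joined p q l -> joined q r l' -> joined p r (l + l').
Proof.
move=> pq; elim/joined_ind: pq => [p0|p0 q0 r0 l0 s _ IH] h; first by rewrite add0r.
by rewrite -addrA; apply: joined_cons s (IH h).
Qed.

Lemma joinedC p q l : joined p q l -> joined q p l.
Proof.
elim/joined_ind => [p0|p0 q0 r0 l0 s _ IH]; first exact: joinedxx.
rewrite addrC; apply: joined_cat IH _; rewrite segment_lengthC.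
exact/joined_same/same_simplexC.
Qed.

Lemma joined_ge0 p q l : joined p q l -> 0 <= l.
Proof.
by elim/joined_ind => // *; rewrite addr_ge0// segment_length_ge0.
Qed.

Lemma path_distE p q : path_dist p q = inf [set l | joined p q l].
Proof.
congr inf; apply/seteqP; split=> [_ [s [ps <-] <-]|l [s [ps pq <-]]].
  by exists s.
by exists s.
Qed.

Lemma path_distC p q : path_dist p q = path_dist q p.
Proof. by rewrite !path_distE; congr inf; apply/seteqP; split=> l /joinedC. Qed.

Lemma path_dist_le p q l : joined p q l -> path_dist p q <= l.
Proof.
move=> pql; rewrite path_distE; apply: ge_inf => //.
by exists 0 => l' /joined_ge0.
Qed.

Lemma path_dist_ge0 p q : 0 <= path_dist p q.
Proof.
rewrite path_distE; have [->|/set0P ne] := eqVneq [set l | joined p q l] set0.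
  by rewrite inf0.
by apply: lb_le_inf => // l /joined_ge0.
Qed.

(** Not a metric condition: [v] is an end of some closed simplex containing [p], so a segment of
    length [1 - p v] leads from [p] to [v]. *)
Definition near_vertex p v := exists A, [/\ simplex K A, in_simplex A p & v \in A].

Fixpoint walk v w (k : nat) : Prop :=
  if k is k'.+1 then
    exists v', [/\ v != v', simplex K [fset v; v']%fset & walk v' w k']
  else v = w.

(* A normal length is that of a string which is either a single segment or of
   the form p, v, ..., w, q, travelling from v to w along full edges. *)
Definition normal p q l :=
  (same_simplex p q /\ l = segment_length p q) \/
  exists v w k, [/\ near_vertex p v, near_vertex q w, walk v w k
    & l = 1 - p v + k%:R + (1 - q w)].

Lemma near_joined p v : near_vertex p v -> joined p (vertex v) (1 - p v).
Proof.
move=> [A [KA pA vA]]; rewrite -(segment_length_vertex KA pA vA).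
by apply: joined_same; exists A; split=> //; exact: in_simplex_vertex.
Qed.

Lemma walk_joined v w k : walk v w k -> joined (vertex v : T) (vertex w) k%:R.
Proof.
elim: k v => [v ->|k IH v [v' [vv' Kvv' /IH v'w]]]; first exact: joinedxx.
have vA : v \in [fset v; v']%fset by rewrite !inE eqxx.
have v'A : v' \in [fset v; v']%fset by rewrite !inE eqxx orbT.
have -> : k.+1%:R = segment_length (vertex v : T) (vertex v') + k%:R.
  rewrite (segment_length_vertex Kvv' (in_simplex_vertex Kvv' vA) v'A).
  by rewrite vertexE eq_sym (negbTE vv') subr0 -natr1 addrC.
by apply: joined_cons v'w; exists [fset v; v']%fset; split=> //; exact: in_simplex_vertex.
Qed.

Lemma normal_joined p q l : normal p q l -> joined p q l.
Proof.
move=> [[pq ->]|[v [w [k [pv qw vw ->]]]]]; first exact: joined_same.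
apply: joined_cat (joinedC (near_joined qw)).
by apply: joined_cat (near_joined pv) (walk_joined vw).
Qed.

(** If both segments at [q] lie in one simplex, the triangle inequality merges them. Otherwise [q]
    is a vertex and a walk can start there. *)
Lemma normal_cons p q r l : same_simplex p q -> normal q r l ->
  exists2 l', normal p r l' & l' <= segment_length p q + l.
Proof.
move=> [A [KA pA qA]] [[[B [KB qB rB]] ->]|[v [w [k [[B [KB qB vB]] rw vw ->]]]]].
- have [AB|[v [vA vB qv]]] := two_simplices_vertex KA KB qA qB.
    subst B; exists (segment_length p r); last exact: segment_length_triangle KA _ _ _.
    by left; split=> //; exists A.
  exists (1 - p v + 0%:R + (1 - r v)).
    by right; exists v, v, 0; split=> //; [exists A|exists B].
  rewrite -(segment_length_vertex KA pA vA) -(segment_length_vertex KB rB vB).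
  by rewrite addr0 qv [segment_length r _]segment_lengthC.
- have [AB|[v' [v'A v'B qv]]] := two_simplices_vertex KA KB qA qB.
    subst B; exists (1 - p v + k%:R + (1 - r w)).
      by right; exists v, w, k; split=> //; exists A.
    rewrite !addrA !lerD2r -!addrA -(segment_length_vertex KA pA vB).
    rewrite -(segment_length_vertex KA qA vB).
    exact: segment_length_triangle KA pA qA (in_simplex_vertex KA vB).
  have -> : segment_length p q = 1 - p v' by rewrite qv (segment_length_vertex KA).
  have [vv'|vv'] := eqVneq v' v.
    exists (1 - p v' + k%:R + (1 - r w)).
      by right; exists v', w, k; split=> //; [exists A|rewrite vv'].
    by rewrite qv vertexE vv' eqxx mulr1n; lra.
  (* Here [q] is the vertex [v'], so the old first segment, from [q] to [v], is a full edge and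
     becomes a step of the walk. *)
  exists (1 - p v' + k.+1%:R + (1 - r w)).
    right; exists v', w, k.+1; split=> //; first by exists A.
    exists v; split=> //; apply: simplex_face KB _ _.
      by apply/fsubsetP => x; rewrite !inE => /orP[]/eqP->.
    by apply/fset0Pn; exists v; rewrite !inE eqxx orbT.
  by rewrite qv vertexE eq_sym (negbTE vv') mulr0n -natr1; lra.
Qed.

Lemma joined_normal p q l : joined p q l -> exists2 l', normal p q l' & l' <= l.
Proof.
elim/joined_ind => [p0|p0 q0 r0 l0 s _ [l1 n1 l10]].
  exists 0 => //; left; split; first exact: same_simplexxx.
  by rewrite segment_lengthxx.
have [l' n' l'l] := normal_cons s n1; exists l' => //.
by apply: le_trans l'l _; rewrite lerD2l.
Qed.

(** Leaves finitely many values for the end terms [1 - p v] of normal lengths, even where infinitely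
    many edges meet at [p]. *)
Lemma finite_range_bary p : finite_set (range p).
Proof.
have [A KA [_ pA _]] := simplex_exists p.
apply: (@sub_finite_set _ _ ((p @` [set` A]) `|` [set 0])).
  move=> _ [v _ <-]; have [vA|/pA ->] := boolP (v \in A); last by right.
  by left; exists v.
by rewrite finite_setU; split; [exact: finite_image|exact: finite_set1].
Qed.

(* Normal lengths up to a given bound form a finite set, so that the infimum in
   the definition of the path metric is attained. *)
Lemma path_dist_normal p q l : joined p q l -> normal p q (path_dist p q).
Proof.
move=> /joined_normal[M nM _] {l}.
pose S := [set l | normal p q l /\ l <= M].
have [] : exists2 m, S m & lbound S m.
- apply: finite_set_min; last by exists M; split.
  (* The end terms are nonnegative, so a normal length at most [M] has fewer than [N] full edges. *)
  pose N := (Num.truncn M).+1.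
  pose F := [set 1 - a + y | a in range p &
                y in [set k%:R + (1 - b) | k in `I_N & b in range q]].
  have finF : finite_set F.
    apply: finite_image2; first exact: finite_range_bary.
    by apply: finite_image2 => //; exact: finite_range_bary.
  apply: (@sub_finite_set _ _ (F `|` [set segment_length p q])).
    move=> l [[[_ ->] _|[v [w [k [_ _ _ ->]]]] lM]]; first by right.
    left; exists (p v); first by exists v.
    exists (k%:R + (1 - q w)); last by rewrite addrA.
    exists k; last by exists (q w) => //; exists w.
    rewrite /= -(ltr_nat R); apply: le_lt_trans (truncnS_gt M).
    by have := bary_le1 p v; have := bary_le1 q w; lra.
  by rewrite finite_setU; split=> //; exact: finite_set1.
- move=> m [nm mM] lbm; suff -> : path_dist p q = m by [].
  apply/eqP; rewrite eq_le path_dist_le//=; last exact: normal_joined.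
  rewrite path_distE; apply: lb_le_inf; first by exists m; exact: normal_joined.
  move=> l /joined_normal[l' nl' l'l]; apply: le_trans l'l.
  have [l'M|Ml'] := leP l' M; first exact: lbm.
  exact: le_trans mM (ltW Ml').
Qed.

End Strings.

(** * Local form of the path metric *)

Section PathMetric.
Context {R : realType} {V : choiceType} {K : simplicial1 V}.
Local Notation T := (realization R K).

Implicit Types (p q r : T) (A B : {fset V}) (v w : V).

(** The distance is a normal length. One with a full edge is at least 1; one through a single vertex
    is controlled by the triangle inequality if that vertex is in the common simplex, and equals 2
    if not. *)
Lemma path_dist_same p q : same_simplex p q -> path_dist p q = segment_length p q.
Proof.
move=> pq; apply/eqP; rewrite eq_le path_dist_le//=; last exact: joined_same.
have := path_dist_normal (joined_same pq).
move=> [[_ ->//]|[v [w [k [[B [KB pB vB]] qw vw ->]]]]].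
have := bary_le1 p v; have := bary_le1 q w; have := segment_length_le1 pq.
case: k vw => [vw|k _]; last first.
  by have := ler0n R k; rewrite -[k.+1%:R]natr1; lra.
rewrite /= in vw; subst w; move: pq => [A [KA pA qA]].
have [vA|vA] := boolP (v \in A); last first.
  by case: pA qA => _ /(_ _ vA) -> _ [_ /(_ _ vA) -> _]; lra.
rewrite (segment_length_coord KA pA qA vA).
by move: (p v) (q v) => a b *; rewrite ler_norml; lra.
Qed.

Lemma path_dist_vertex p v : near_vertex p v -> path_dist p (vertex v) = 1 - p v.
Proof.
move=> [A [KA pA vA]]; have vvA := @in_simplex_vertex R _ _ _ _ KA vA.
rewrite path_dist_same ?(segment_length_vertex KA)//.
by exists A.
Qed.

Lemma bary_gap p : exists e : R, [/\ 0 < e, e <= 1 & forall v, p v < 1 -> p v <= 1 - e].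
Proof.
have [A KA pA] := simplex_exists p; have [v vA pv0] := bary_support KA pA.
have [pv1|pv1] := ltP (p v) 1.
  have [w [wA Aw vw pw]] := bary_lt1_pair KA pA vA pv1.
  have [m [m0 mv mv']] : exists m : R, [/\ 0 < m, m <= p v & m <= 1 - p v].
    exists (Num.min (p v) (1 - p v)).
    by split; rewrite ?ge_min ?lexx ?orbT// lt_min pv0 subr_gt0.
  exists m; split=> //; first exact: le_trans mv (bary_le1 p v).
  move=> x _; have [xA|xA] := boolP (x \in A); last first.
    by have [_ /(_ _ xA) -> _] := pA; lra.
  by move: xA; rewrite Aw !inE => /orP[]/eqP->; rewrite ?pw; lra.
exists 1; split=> // x; have [->|xv] := eqVneq x v; first by lra.
have -> : p = vertex v by apply: eq_vertex; have := bary_le1 p v; lra.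
by rewrite vertexE (negbTE xv) mulr0n; lra.
Qed.

Section Connected.
Context (conK : forall p q, exists l, joined p q l).

Lemma path_dist_joined p q : joined p q (path_dist p q).
Proof. by have [l /path_dist_normal/normal_joined] := conK p q. Qed.

Lemma path_dist_triangle p q r : path_dist p r <= path_dist p q + path_dist q r.
Proof. exact/path_dist_le/joined_cat/path_dist_joined/path_dist_joined. Qed.

(** Leaving [p] through a vertex other than [p] costs at least [e], and so does a full edge when [p]
    is a vertex. *)
Lemma path_dist_lt_same p q (e : R) : e <= 1 ->
  (forall v, p v < 1 -> p v <= 1 - e) -> path_dist p q < e -> same_simplex p q.
Proof.
move=> e1 pe; have [l /path_dist_normal[[]//|[v [w [k [pv qw vw ->]]]] lt_e]] := conK p q.
have pv1 : p v = 1.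
  apply/eqP; rewrite eq_le bary_le1 leNgt; apply/negP => /pe.
  by have := ler0n R k; have := bary_le1 q w; lra.
case: k vw lt_e => [/= vw _|k _]; last first.
  by have := ler0n R k; have := bary_le1 q w; rewrite -natr1; lra.
subst w; have [B [KB qB wB]] := qw.
by exists B; split=> //; rewrite (eq_vertex pv1); exact: in_simplex_vertex.
Qed.

Lemma path_dist_small p :
  exists2 e : R, 0 < e & forall q, path_dist p q < e -> same_simplex p q.
Proof.
have [e [e0 e1 pe]] := bary_gap p; exists e => // q; exact: (path_dist_lt_same e1 pe).
Qed.

Lemma path_dist_eq0 p q : path_dist p q = 0 -> p = q.
Proof.
move=> pq0; have [e e0 /(_ q)] := path_dist_small p; rewrite pq0 => /(_ e0) pq.
by apply: segment_length_eq0 (pq) _; rewrite -path_dist_same.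
Qed.

(** * Unit-speed paths and existence of geodesics *)

Lemma segment_path p q : same_simplex p q -> exists u : R -> T,
  [/\ u 0 = p, u (segment_length p q) = q &
    forall a b, 0 <= a -> a <= b -> b <= segment_length p q -> joined (u a) (u b) (b - a)].
Proof.
move=> pq; have [A [KA pA qA]] := pq; set l := segment_length p q.
have l0 : 0 <= l by exact: segment_length_ge0.
(* Affine interpolation at unit speed; for [l = 0] the quotient [t / l] is 0 and the path stays at
   [p = q]. *)
have /choice[u uP] : forall t, exists r, 0 <= t <= l ->
    in_simplex A r /\ forall w, r w = p w + t / l * (q w - p w).
  move=> t; have [tl|?] := pselect (0 <= t <= l); last by exists p.
  have s0 : 0 <= t / l by case/andP: tl => ? ?; rewrite divr_ge0.
  have s1 : t / l <= 1.
    case/andP: tl => t0 tl; have [l00|l_n0] := eqVneq l 0; first by rewrite l00 invr0 mulr0.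
    by rewrite ler_pdivrMr ?mul1r// lt0r l_n0.
  move: (t / l) s0 s1 => s s0 s1.
  have rA : in_simplex A (fun w => p w + s * (q w - p w)).
    case: pA qA => p0 pA p1 [q0 qA q1]; split.
    - by move=> w; have := p0 w; have := q0 w; nra.
    - by move=> w wA; rewrite pA// qA// subrr mulr0 addr0.
    - by rewrite big_split/= -mulr_sumr sumrB p1 q1 subrr mulr0 addr0.
  by exists (Point (ex_intro2 _ _ A KA rA)).
have [w wA] := simplex_mem KA.
have lw : l = `|p w - q w| by rewrite /l (segment_length_coord KA pA qA wA).
exists u; split.
- have [|uA uE] := uP 0; first by rewrite lexx l0.
  by apply: (in_simplex_ext KA uA pA wA); rewrite uE !mul0r addr0.
- have [|uA uE] := uP l; first by rewrite lexx l0.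
  apply: (in_simplex_ext KA uA qA wA); rewrite uE.
  have [l00|l_n0] := eqVneq l 0; last by rewrite divff// mul1r; lra.
  move: lw; rewrite l00 mul0r => /esym/eqP; rewrite normr_eq0 subr_eq0 => /eqP->.
  by rewrite mul0r addr0.
- move=> a b a0 ab bl.
  have [|aA aE] := uP a; first by rewrite a0 (le_trans ab bl).
  have [|bA bE] := uP b; first by rewrite (le_trans a0 ab) bl.
  suff -> : b - a = segment_length (u a) (u b) by apply: joined_same; exists A.
  rewrite (segment_length_coord KA aA bA wA) aE bE.
  have [l00|l_n0] := eqVneq l 0.
    by rewrite l00 invr0 !mulr0 !mul0r subrr normr0; lra.
  have -> : p w + a / l * (q w - p w) - (p w + b / l * (q w - p w)) =
    (b - a) / l * (p w - q w) by field.
  rewrite normrM -lw ger0_norm; first by rewrite divfK.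
  by rewrite divr_ge0// subr_ge0.
Qed.

Lemma string_path p q l : joined p q l -> exists u : R -> T,
  [/\ u 0 = p, u l = q &
    forall a b, 0 <= a -> a <= b -> b <= l -> joined (u a) (u b) (b - a)].
Proof.
elim/(@joined_ind R V K) => {p q l} [p|p q r l pq qr [u2 [u20 u2l u2P]]].
  exists (cst p); split=> // a b a0 ab b0.
  have -> : b - a = 0 by lra.
  exact: joinedxx.
have [u1 [u10 u1l u1P]] := segment_path pq; set m := segment_length p q in u1l u1P *.
have m0 : 0 <= m by exact: segment_length_ge0.
have l0 := joined_ge0 qr.
exists (fun t => if t <= m then u1 t else u2 (t - m)); split.
- by rewrite m0.
- case: ifPn => [lm|_]; last by rewrite -/m [m + l]addrC addrK.
  have l00 : l = 0 by lra.
  by rewrite l00 addr0 u1l -u20 -u2l l00.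
- move=> a b a0 ab bl; have [bm|mb] := leP b m.
    by rewrite (le_trans ab bm); exact: u1P.
  have [am|ma] := leP a m; last first.
    have -> : b - a = (b - m) - (a - m) by lra.
    by apply: u2P; lra.
  have -> : b - a = (m - a) + (b - m - 0) by lra.
  apply: (@joined_cat _ _ _ _ q); first by rewrite -[X in joined _ X _]u1l; apply: u1P.
  by rewrite -{1}u20; apply: u2P; lra.
Qed.

(** The distance is attained by a string; its unit-speed path admits no shortcut, which would bring
    the ends closer than their distance. *)
Lemma geod_isometric p q : isometric_path p q (geod p q).
Proof.
apply: xgetPex; have [u [u0 ul uP]] := string_path (path_dist_joined p q).
exists u; split=> //.
have le_u a b : 0 <= a -> a <= b -> b <= path_dist p q ->
    path_dist (u a) (u b) = b - a.
  move=> a0 ab bl; apply/eqP; rewrite eq_le path_dist_le/=; last exact: uP.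
  have pa : path_dist p (u a) <= a.
    by apply: path_dist_le; rewrite -u0 -[X in joined _ _ X]subr0; apply: uP; lra.
  have bq : path_dist (u b) q <= path_dist p q - b.
    by apply: path_dist_le; rewrite -{1}ul; apply: uP; lra.
  by have := path_dist_triangle p (u a) q; have := path_dist_triangle (u a) (u b) q; lra.
move=> s t; rewrite !in_itv/= => /andP[s0 sd] /andP[t0 td].
have [st|/ltW ts] := leP s t; first by rewrite distrC ger0_norm ?subr_ge0// le_u.
by rewrite ger0_norm ?subr_ge0// path_distC le_u.
Qed.

End Connected.
End PathMetric.

(** * Lifting maps to the circle *)

Section Circle.
Context {R : realType}.

Lemma int_num_eq0 (x : R) : x \is a Num.int -> `|x| < 1 -> x = 0.
Proof.
by move=> xZ x1; apply: contraTeq x1 => /(norm_intr_ge1 xZ); rewrite -leNgt.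
Qed.

(* The representative in [-1/2, 1/2[ of x modulo 1. *)
Definition crep (x : R) := x - (Num.floor (x + 2^-1))%:~R.

Lemma crep_int (x : R) : x - crep x \is a Num.int.
Proof. by rewrite /crep opprB addrC subrK intr_int. Qed.

Lemma crep_bound (x : R) : `|crep x| <= 2^-1.
Proof.
have := floor_le (x + 2^-1); have := floorD1_gt (x + 2^-1).
by rewrite /crep ler_norml intrD; lra.
Qed.

Lemma crep_unique (x y : R) : x - y \is a Num.int -> `|y| < 2^-1 -> crep x = y.
Proof.
move=> xyZ y2; apply/eqP; rewrite -subr_eq0; apply/eqP/int_num_eq0.
  have -> : crep x - y = (x - y) - (x - crep x) by ring.
  by rewrite rpredB// crep_int.
by apply: le_lt_trans (ler_normB _ _) _; have := crep_bound x; lra.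
Qed.

(** The absolute value of [crep x] is the distance from [x] to the nearest integer, that is, the
    norm on R / Z. *)
Lemma crep_le (x y : R) : x - y \is a Num.int -> `|crep x| <= `|y|.
Proof.
move=> xyZ; have [y2|] := ltP `|y| 2^-1; first by rewrite (crep_unique xyZ).
exact/le_trans/crep_bound.
Qed.

Lemma norm_crepN (x : R) : `|crep (- x)| = `|crep x|.
Proof.
apply/eqP; rewrite eq_le; apply/andP; split.
  rewrite -[leRHS]normrN; apply: crep_le.
  by rewrite -opprD rpredN; exact: crep_int.
rewrite -[leRHS]normrN; apply: crep_le.
by have := crep_int (- x); rewrite -rpredN opprD !opprK.
Qed.

Lemma crepD (x y : R) : `|crep (x + y)| <= `|crep x| + `|crep y|.
Proof.
apply: le_trans (ler_normD _ _); apply: crep_le.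
by rewrite opprD addrACA rpredD// crep_int.
Qed.

Lemma within_continuousD {X : topologicalType} (C : set X) (f g : X -> R) :
  {within C, continuous f} -> {within C, continuous g} ->
  {within C, continuous (fun x => f x + g x)}.
Proof.
move=> /subspace_continuousP fc /subspace_continuousP gc.
by apply/subspace_continuousP => x Cx; apply: cvgD; [exact: fc|exact: gc].
Qed.

Lemma within_continuous_cst {X : topologicalType} (C : set X) (c : R) :
  {within C, continuous (fun _ : X => c)}.
Proof. by apply/subspace_continuousP => x Cx; exact: cvg_cst. Qed.

(** Values with different floors enclose an integer, the larger floor, which would be attained. *)
Lemma floor_IVT (k : R -> R) (a b : R) : a <= b -> {within `[a, b], continuous k} ->
  {in `[a, b], forall s, k s \isn't a Num.int} -> Num.floor (k a) = Num.floor (k b).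
Proof.
move=> ab kc kZ; apply/eqP/negPn/negP => neq.
have [n] : exists n : int, Num.min (k a) (k b) <= n%:~R <= Num.max (k a) (k b).
  have := neq; rewrite neq_lt => /orP[]; rewrite floor_lt_int => lt.
    exists (Num.floor (k b)); rewrite ge_min le_max floor_le orbT andbT.
    by rewrite (ltW lt).
  exists (Num.floor (k a)); rewrite ge_min le_max floor_le andbT.
  by rewrite (ltW lt) orbT.
move=> /(IVT ab kc)[c cab kcn]; have := kZ c cab.
by rewrite kcn intr_int.
Qed.

(** After adding 1/2 the function avoids the integers, so its floor cannot change. *)
Lemma int_valued_constant (k : R -> R) (a b : R) : a <= b ->
  {within `[a, b], continuous k} ->
  {in `[a, b], forall s, k s \is a Num.int} -> k a = k b.
Proof.
move=> ab kc kZ; have half : (2^-1 : R) \isn't a Num.int.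
  by apply/negP => /int_num_eq0; rewrite ger0_norm ?invr_ge0//; lra.
have := @floor_IVT (fun s => k s + 2^-1) a b ab.
have aab : a \in `[a, b] by rewrite in_itv/= lexx.
have bab : b \in `[a, b] by rewrite in_itv/= lexx andbT.
rewrite !floorDzr ?kZ// => flk.
have /addIr : Num.floor (k a) + Num.floor (2^-1 : R) = Num.floor (k b) + Num.floor (2^-1 : R).
  apply: flk.
    exact: within_continuousD kc (@within_continuous_cst _ _ _).
  by move=> s sab; apply: contra half => /rpredB/(_ (kZ s sab)); rewrite addrAC subrr add0r.
by move=> e; rewrite -(floorK (kZ _ aab)) e floorK// kZ.
Qed.

(** Connectedness of the segment: the indicator of [P] is continuous and integer-valued. *)
Lemma locally_constant_segment (P : R -> Prop) (a b : R) : a <= b ->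
  (forall t, t \in `[a, b] -> \forall s \near t, s \in `[a, b] -> (P s <-> P t)) ->
  P b -> P a.
Proof.
move=> ab Pl Pb; pose f t : R := (asbool (P t))%:R.
suff : f a = f b.
  by rewrite /f (asboolT Pb); case: asboolP => // _ /eqP; rewrite eq_sym oner_eq0.
apply: (int_valued_constant ab); last by move=> s _; rewrite natr_int.
apply/subspace_continuousP => t tab; apply: cvg_near_cst.
rewrite /within /=; have := Pl t tab; apply: filterS => s + sab => /(_ sab) Pst.
by rewrite /from_subspace /f (asbool_equiv_eq Pst).
Qed.

(** Continuity as a map to R / Z; [phi] itself may jump by integers. *)
Definition circle_continuous {X : topologicalType} (phi : X -> R) :=
  forall x e, 0 < e -> \forall y \near x, `|crep (phi y - phi x)| < e.

Lemma homotopy_near {X Y : topologicalType} (H : X * R -> Y) (x : X) (t : R) (W : set Y) :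
  {within [set: X] `*` `[0, 1], continuous H} -> t \in `[0, 1] -> nbhs (H (x, t)) W ->
  \forall y \near x & s \near t, s \in `[0, 1] -> W (H (y, s)).
Proof.
move=> /subspace_continuousP Hc t01 /(Hc (x, t) (conj I t01)).
rewrite /nbhs/= /within/=; apply: filterS => -[y s] /= + s01.
by apply; split.
Qed.

(* Homotopy lifting: along a contraction of X the map phi to the circle R / Z is
   changed little by little, each time by a function that lifts to R. *)
Lemma contractible_lift {X : topologicalType} (phi : X -> R) (C : set X) :
  contractible R X -> circle_continuous phi -> compact C ->
  exists2 h : X -> R, {within C, continuous h} &
    forall x, C x -> phi x - h x \is a Num.int.
Proof.
move=> [x0 [H [Hc H0 H1]]] phic cC.
pose lifts t h := {within C, continuous h} /\
  forall x, C x -> phi (H (x, t)) - h x \is a Num.int.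
(* A bound of 1/4 keeps the change between two stages away from 1/2, where [crep] jumps, so that its
   representative is continuous. *)
pose close t s := forall x, C x -> `|crep (phi (H (x, s)) - phi (H (x, t)))| < 4^-1.
have closeC t s : close t s -> close s t.
  by move=> c x /c; rewrite -norm_crepN opprB.
have slice t x e : t \in `[0, 1] -> 0 < e ->
    \forall y \near x, `|crep (phi (H (y, t)) - phi (H (x, t)))| < e.
  move=> t01 e0; have := homotopy_near Hc t01 (phic (H (x, t)) e e0).
  move=> /nearP_dep; apply: filterS => y; move=> /nbhs_singleton; exact.
have step t s : t \in `[0, 1] -> s \in `[0, 1] -> close t s ->
    (exists h, lifts t h) -> exists h, lifts s h.
  move=> t01 s01 ts [h [hc hP]].
  pose g x := crep (phi (H (x, s)) - phi (H (x, t))).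
  exists (fun x => h x + g x); split; last first.
    move=> x Cx; have := rpredD (hP x Cx) (crep_int (phi (H (x, s)) - phi (H (x, t)))).
    by apply: etrans; congr (_ \is a Num.int); rewrite /g; ring.
  suff gc : {within C, continuous g} by exact: within_continuousD.
  apply/subspace_continuousP => x Cx; apply/cvgrPdist_lt => e e0.
  (* A value below 1/4 changed by less than [2 * d <= 1/4] stays below 1/2, whence [gE]; the bound
     [d <= e / 2] gives the final estimate. *)
  pose d : R := Num.min (e / 2) 8^-1.
  have d0 : 0 < d by rewrite lt_min divr_gt0//= invr_gt0.
  have de : d <= e / 2 by rewrite ge_min lexx.
  have d8 : d <= 8^-1 by rewrite ge_min lexx orbT.
  near=> y; have Cy : C y by near: y; exact: withinT.
  have ys : `|crep (phi (H (y, s)) - phi (H (x, s)))| < d.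
    by near: y; apply: cvg_within; exact: slice.
  have yt : `|crep (phi (H (y, t)) - phi (H (x, t)))| < d.
    by near: y; apply: cvg_within; exact: slice.
  have := ts x Cx; rewrite -/(g x) => gx.
  have gE : g y = g x + crep (phi (H (y, s)) - phi (H (x, s)))
                  - crep (phi (H (y, t)) - phi (H (x, t))).
    apply: crep_unique.
      have Zs := crep_int (phi (H (y, s)) - phi (H (x, s))).
      have Zt := crep_int (phi (H (y, t)) - phi (H (x, t))).
      have := rpredD (rpredB Zs Zt) (crep_int (phi (H (x, s)) - phi (H (x, t)))).
      by apply: etrans; congr (_ \is a Num.int); rewrite /g; ring.
    by move: gx ys yt; rewrite !ltr_norml; lra.
  by rewrite /from_subspace gE; move: ys yt; rewrite !ltr_norml; lra.
have [h [hc hP]] : exists h, lifts 0 h; last first.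
  by exists h => // x Cx; have := hP x Cx; rewrite H0.
(* The contraction is followed back from stage 1, where the map is constant and lifted by a
   constant. *)
apply: (@locally_constant_segment (fun t => exists h, lifts t h) 0 1) => //; last first.
  exists (cst (phi x0)); split; first exact: within_continuous_cst.
  by move=> x _; rewrite H1 subrr rpred0.
move=> t t01; suff : \forall s \near t, s \in `[0, 1] -> close t s.
  apply: filterS => s + s01 => /(_ s01) ts.
  by split; apply: step => //; exact: closeC.
(* Compactness makes closeness of the stages near each point uniform over [C]; the bound 1/4 splits
   into two errors of 1/8. *)
have /compact_near_coveringP ncC := cC.
apply: filterS (ncC R (nbhs t) (fun s x => s \in `[0, 1] ->
    `|crep (phi (H (x, s)) - phi (H (x, t)))| < 4^-1) _ _).
  by move=> s h s01 x /h; apply.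
move=> x Cx; have e0 : 0 < 8^-1 :> R by rewrite invr_gt0.
have [[A B] /= [Ax Bt] AB] := homotopy_near Hc t01 (phic (H (x, t)) _ e0).
exists (A `&` [set y | `|crep (phi (H (y, t)) - phi (H (x, t)))| < 8^-1], B).
  by split=> //; apply: filterI => //; exact: slice.
move=> [y s] /= [[Ay yt] Bs] s01; have ys := AB (y, s) (conj Ay Bs) s01.
have -> : phi (H (y, s)) - phi (H (y, t)) =
  (phi (H (y, s)) - phi (H (x, t))) + - (phi (H (y, t)) - phi (H (x, t))) by ring.
apply: le_lt_trans (crepD _ _) _; rewrite norm_crepN.
by rewrite /= in ys; lra.
Unshelve. all: by end_near. Qed.

End Circle.

(** * Paths in the complex *)

Lemma finite_common_radius {R : realType} {I : choiceType} (D : set I) (P : I -> R -> Prop) :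
  finite_set D ->
  (forall i, D i -> exists2 e : R, 0 < e & forall e', 0 < e' -> e' <= e -> P i e') ->
  exists2 e : R, 0 < e & forall i, D i -> P i e.
Proof.
move=> /finite_seqP[s ->] {D} Ps.
suff [e e0 eP] : exists2 e : R, 0 < e & forall e', 0 < e' -> e' <= e ->
    forall i, i \in s -> P i e' by exists e => // i si; exact: eP.
elim: s Ps => [_|i s IH Ps]; first by exists 1.
have [e1 e10 e1P] := Ps i (mem_head i s).
have [|e2 e20 e2P] := IH; first by move=> j sj; apply: Ps; rewrite /= inE sj orbT.
exists (Num.min e1 e2); first by rewrite lt_min e10.
move=> e' e'0; rewrite le_min => /andP[e'1 e'2] j; rewrite inE => /orP[/eqP->|].
  exact: e1P.
exact: e2P.
Qed.

Lemma clamp_lipschitz {R : realType} (x y : R) :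
  `|Num.max 0 (Num.min 1 x) - Num.max 0 (Num.min 1 y)| <= `|x - y|.
Proof.
wlog xy : x y / x <= y => [h|].
  by have [/h//|/ltW/h] := leP x y; rewrite distrC [leRHS]distrC.
rewrite distrC [leRHS]distrC [leRHS]ger0_norm ?subr_ge0//.
have [x1|/ltW x1] := leP 1 x.
  by rewrite (min_l (le_trans x1 xy)) subrr normr0 subr_ge0.
rewrite ler_norml; have [y1|/ltW y1] := leP 1 y.
  by rewrite (@max_r _ _ 0 1)//; have [x0|x0] := leP 0 x; lra.
by have [x0|x0] := leP 0 x; have [y0|y0] := leP 0 y; lra.
Qed.

(** * Topology of the complex and the path metric *)

Section ComplexTopology.
Context {R : realType} {V : choiceType} {K : simplicial1 V}.
Local Notation T := (realization R K).

Implicit Types (p q r : T) (A B : {fset V}) (v w : V).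

(** Being joined to [x0] is constant on each closed simplex, so it defines an open and closed set;
    the track of a point under the contraction ends at [x0] and so lies in it. *)
Lemma contractible_joined : geometric_tree R K -> forall p q, exists l, joined p q l.
Proof.
move=> [x0 [H [Hc H0 H1]]].
suff joined_x0 p : exists l, joined p x0 l.
  move=> p q; have [l pl] := joined_x0 p; have [l' ql'] := joined_x0 q.
  by exists (l + l'); exact/(joined_cat pl)/joinedC.
pose S q := exists l, joined q x0 l.
have S_same q r : same_simplex q r -> S r -> S q.
  by move=> qr [l rl]; exists (segment_length q r + l); exact: joined_cons.
rewrite -(H0 p); apply: (@locally_constant_segment R (fun t => S (H (p, t))) 0 1) => //;
  last first.
  by rewrite H1; exists 0; exact: joinedxx.
move=> t t01; have oS : open [set q | S q <-> S (H (p, t))].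
  move=> A KA q Aq Sq; exists 1 => // r Ar _ /=.
  have qr : S r <-> S q by split; apply: S_same; exists A.
  by split=> [/qr/Sq|/Sq/qr].
have := homotopy_near Hc t01 (open_nbhs_nbhs (conj oS (iff_refl _))).
by move=> /nearP_dep/nbhs_singleton.
Qed.

Context (lfK : locally_finite K).
Context (conK : forall p q, exists l, joined p q l).

(** Points close to [p] share a simplex with it, and by local finiteness only finitely many
    simplices contain [p], so one radius serves them all. *)
Lemma path_dist_nbhs p (U : set T) : nbhs p U ->
  exists2 e : R, 0 < e & forall q, path_dist p q < e -> U q.
Proof.
rewrite nbhsE => -[W [oW Wp] WU].
pose D := [set A | simplex K A /\ in_simplex A p].
have finD : finite_set D.
  have [A KA pA] := simplex_exists p; have [v vA pv] := bary_support KA pA.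
  apply: sub_finite_set (lfK v) => B [KB pB]; split=> //.
  exact: bary_gt0_mem pB pv.
have [e1 e10 same] := path_dist_small conK p.
have [|e2 e20 e2P] := @finite_common_radius R _ D (fun A e => forall q,
    in_simplex A q -> segment_length p q < e -> W q) finD.
  move=> A [KA pA]; have [e e0 eW] := oW A KA p pA Wp.
  by exists e => // e' _ e'e q qA pq; apply: eW => //; exact: lt_le_trans pq e'e.
exists (Num.min e1 e2); first by rewrite lt_min e10.
move=> q; rewrite lt_min => /andP[pq1 pq2]; apply: WU.
have [A [KA pA qA]] := same q pq1.
by apply: (e2P A) => //; rewrite -path_dist_same//; exists A.
Qed.

Lemma isometric_continuous p q u : isometric_path p q u ->
  {within `[0, path_dist p q], continuous u}.
Proof.
move=> [_ _ iso]; apply/subspace_continuousP => t t0d U /path_dist_nbhs[e e0 eU].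
apply/nbhs_ballP; exists e => //= s ts s0d; apply: eU.
by rewrite iso ?inE//; exact: ts.
Qed.

(** * A circle-valued bump on an edge *)

Section Bump.
Context (A : {fset V}) (w : V) (a e : R).

(** Rises linearly from 0 at [a - e] to 1 at [a + e]; the constant values on the two sides agree
    modulo 1. *)
Definition ramp (s : R) := Num.max 0 (Num.min 1 ((s - a + e) / (2 * e))).

(* Read modulo 1, this collapses to a point all of the complex but the interval
   of radius e around the point of A with coordinate a at w. *)
Definition bump (q : T) : R := if `[< in_simplex A q >] then ramp (q w) else 0.

Lemma ramp_lipschitz s t : 0 < e -> `|ramp s - ramp t| <= `|s - t| / (2 * e).
Proof.
move=> e0; have e2 : 0 < 2 * e by lra.
have -> : `|s - t| / (2 * e) = `|(s - a + e) / (2 * e) - (t - a + e) / (2 * e)|.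
  rewrite -mulrBl normrM [X in _ = _ * X]gtr0_norm ?invr_gt0//.
  by congr (`|_| / _); ring.
exact: clamp_lipschitz.
Qed.

Lemma rampE s : 0 < e -> `|s - a| <= e -> ramp s = (s - a + e) / (2 * e).
Proof.
move=> e0; rewrite ler_norml => /andP[s1 s2]; rewrite /ramp.
have e2 : 0 < 2 * e by lra.
rewrite min_r ?max_r//.
  by rewrite divr_ge0//; lra.
by rewrite ler_pdivrMr//; lra.
Qed.

Lemma ramp_lt s : 0 < e -> s <= a - e -> ramp s = 0.
Proof.
move=> e0 s1; have e2 : 0 < 2 * e by lra.
by rewrite /ramp max_l// ge_min pmulr_lle0 ?invr_gt0//; apply/orP; right; lra.
Qed.

Lemma ramp_gt s : 0 < e -> a + e <= s -> ramp s = 1.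
Proof.
move=> e0 s1; have e2 : 0 < 2 * e by lra.
by rewrite /ramp min_l ?max_r// ler_pdivlMr//; lra.
Qed.

Lemma ramp_far s : 0 < e -> e <= `|s - a| -> ramp s \is a Num.int.
Proof.
move=> e0; rewrite ler_normr => /orP[es|es].
  by rewrite ramp_gt ?int_num1//; lra.
by rewrite ramp_lt ?int_num0//; lra.
Qed.

Lemma bumpE q : in_simplex A q -> bump q = ramp (q w).
Proof. by move=> qA; rewrite /bump asboolT. Qed.

(** Another simplex meets [A] only in vertices, whose coordinates 0 and 1 lie outside the open
    interval of radius [e] around [a]. *)
Lemma bump_other B q : simplex K A -> 0 < e -> e <= a -> a <= 1 - e ->
  simplex K B -> in_simplex B q -> B != A ->
  bump q \is a Num.int.
Proof.
move=> KA e0 ea ae KB qB BA; rewrite /bump; case: asboolP => [qA|_]; last exact: int_num0.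
apply: ramp_far => //; have [BA'|[v [vB vA qv]]] := two_simplices_vertex KB KA qB qA.
  by rewrite BA' eqxx in BA.
rewrite qv vertexE; case: eqP => _ /=.
  by rewrite ger0_norm; lra.
by rewrite ltr0_norm; lra.
Qed.

(** On simplices other than [A] the bump is constant modulo 1; on [A] it is Lipschitz with constant
    [1 / (2 * e)]. *)
Lemma bump_circle_continuous :
  simplex K A -> w \in A -> 0 < e -> e <= a -> a <= 1 - e -> circle_continuous bump.
Proof.
move=> KA wA e0 ea ae q0 d d0.
pose U := [set q | `|crep (bump q - bump q0)| < d].
suff oU : open U.
  apply: open_nbhs_nbhs; split=> //.
  rewrite /U /= subrr; suff -> : crep 0 = 0 :> R by rewrite normr0.
  by apply: crep_unique; rewrite ?subrr ?normr0 ?invr_gt0.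
move=> B KB p pB Up; have [BA|BA] := eqVneq B A; last first.
  exists 1 => // q qB _; rewrite /U /=; apply: le_lt_trans Up; apply: crep_le.
  have := rpredB (bump_other KA e0 ea ae KB qB BA) (bump_other KA e0 ea ae KB pB BA).
  move=> /rpredD/(_ (crep_int (bump p - bump q0))).
  by apply: etrans; congr (_ \is a Num.int); ring.
subst B; pose g := d - `|crep (bump p - bump q0)|.
have g0 : 0 < g by rewrite subr_gt0.
exists (g * (2 * e)); first by rewrite mulr_gt0//; lra.
move=> q qA; rewrite (segment_length_coord KA pB qA wA) => pq.
rewrite /U /=.
have -> : bump q - bump q0 = (bump q - bump p) + (bump p - bump q0) by ring.
apply: le_lt_trans (crepD _ _) _.
have : `|crep (bump q - bump p)| < g; last by rewrite /g; lra.
apply: (@le_lt_trans _ _ `|bump q - bump p|); first by apply: crep_le; rewrite subrr int_num0.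
rewrite !bumpE// distrC; apply: le_lt_trans (ramp_lipschitz _ _ e0) _.
by rewrite ltr_pdivrMr//; lra.
Qed.

End Bump.
End ComplexTopology.

(** * Geodesics in a locally finite tree *)

Section Tree.
Context {R : realType} {V : choiceType} {K : simplicial1 V}.
Local Notation T := (realization R K).

Implicit Types (p q r x y z : T) (A B : {fset V}) (v w : V).

Lemma within_continuous_lipschitz (f : R -> R) (a b M : R) : 0 < M ->
  {in `[a, b] &, forall s t, `|f s - f t| <= M * `|s - t|} ->
  {within `[a, b], continuous f}.
Proof.
move=> M0 fM; apply/subspace_continuousP => t tab; apply/cvgrPdist_lt => e e0.
apply/nbhs_ballP; exists (e / M) => /=; first by rewrite divr_gt0.
move=> s ts sab; apply: le_lt_trans (fM t s tab sab) _.
by rewrite mulrC -ltr_pdivlMr.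
Qed.

Lemma within_continuous_along (c : R -> T) (a b : R) (C : set T) (h : T -> R) :
  {within `[a, b], continuous c} -> (forall s, s \in `[a, b] -> C (c s)) ->
  {within C, continuous h} -> {within `[a, b], continuous (h \o c)}.
Proof.
move=> /subspace_continuousP cc cC /subspace_continuousP hc.
apply/subspace_continuousP => s sab U hU.
have near_s : \forall t \near s, t \in `[a, b] -> C (c t) -> U (h (c t)).
  exact: cc s sab _ (hc (c s) (cC s sab) U hU).
rewrite /nbhs/= /within/=; apply: filterS near_s => t tU tab.
exact: tU tab (cC t tab).
Qed.

Context (treeK : geometric_tree R K).
Context (lfK : locally_finite K).

Let conK : forall p q, exists l, joined p q l := contractible_joined treeK.

Lemma compact_im_geod x y : compact (im_geod x y).
Proof.
apply: (@continuous_compact _ _ (geod x y)); last exact: segment_compact.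
exact: (isometric_continuous lfK conK (geod_isometric conK x y)).
Qed.

(** The distance to [p] attains its minimum along the geodesic and vanishes only at [p]. *)
Lemma im_geod_far x y p : ~ im_geod x y p ->
  exists2 d : R, 0 < d & forall q, im_geod x y q -> d <= path_dist p q.
Proof.
move=> xyp; have [_ _ iso] := geod_isometric conK x y.
have d0 : 0 <= path_dist x y by exact: path_dist_ge0.
have [|c cd cmin] := EVT_min (f := fun s => path_dist p (geod x y s)) d0.
  apply: (@within_continuous_lipschitz _ _ _ 1) => // s t sd td.
  rewrite mul1r -(iso s t)// ler_norml.
  have := path_dist_triangle conK p (geod x y s) (geod x y t).
  have := path_dist_triangle conK p (geod x y t) (geod x y s).
  by rewrite [path_dist (geod x y t) _]path_distC; lra.
exists (path_dist p (geod x y c)); last by move=> _ [s sd <-]; exact: cmin.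
rewrite lt0r path_dist_ge0 andbT; apply: contra_notN xyp => /eqP /(path_dist_eq0 conK) ->.
by exists c.
Qed.

(* The lift of the bump at p changes by exactly one along the geodesic from x to
   z, which crosses p, but stays between two consecutive half-integers along the
   other two geodesics. *)
Lemma geod_separates x y z t w : 0 < t -> t < path_dist x z ->
  0 < geod x z t w -> geod x z t w < 1 ->
  im_geod x y (geod x z t) \/ im_geod y z (geod x z t).
Proof.
set u := geod x z; set D := path_dist x z; set p := u t => t0 tD pw0 pw1.
apply: contrapT => /not_orP[xyp yzp].
have [u0 uD iso] := geod_isometric conK x z; rewrite -/u -/D in u0 uD iso.
have [A KA pA] := simplex_exists p.
have wA : w \in A by exact: bary_gt0_mem pA pw0.
set a := p w in pw0 pw1.
have [e1 e10 small] := path_dist_small conK p.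
(* The bounds by [a] and [1 - a] keep the interval of radius [e] inside the edge, those by [t] and
   [D - t] inside the geodesic, and [e < e1] keeps nearby points in a common simplex with [p]. *)
have [e [e0 ee1 ea [ae et etD]]] : exists e : R, [/\ 0 < e, e < e1, e <= a &
    [/\ a <= 1 - e, e <= t & e <= D - t]].
  exists (Num.min (e1 / 2) (Num.min (Num.min a (1 - a)) (Num.min t (D - t)))).
  set m := Num.min _ _.
  have : m <= m by [].
  rewrite {2}/m !le_min => /andP[m1 /andP[/andP[m2 m3] /andP[m4 m5]]].
  have m0 : 0 < m by rewrite /m !lt_min pw0 t0 !subr_gt0 pw1 tD divr_gt0.
  by split=> //; [lra|split=> //; lra].
have half : (2^-1 : R) \isn't a Num.int.
  by apply/negP => /int_num_eq0; rewrite ger0_norm ?invr_ge0//; lra.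
pose phi := bump (K := K) A w a e.
have phic : circle_continuous phi by exact: bump_circle_continuous.
have phi_far q : e <= path_dist p q -> phi q \is a Num.int.
  move=> epq; rewrite /phi /bump; case: asboolP => [qA|_]; last exact: int_num0.
  apply: ramp_far => //; rewrite distrC -(segment_length_coord KA pA qA wA).
  by rewrite -path_dist_same//; exists A.
(* Modulo 1 the ramp takes the value 1/2 only at its centre, that is, at [p]. *)
have phi_half q : phi q + 2^-1 \is a Num.int -> q = p.
  rewrite /phi /bump; case: asboolP => [qA|_]; last by rewrite add0r (negbTE half).
  have [qe|qe] := leP e `|q w - a|.
    by move=> /rpredB/(_ (ramp_far e0 qe)); rewrite addrAC subrr add0r (negbTE half).
  rewrite (rampE e0 (ltW qe)) => /rpredB/(_ (@int_num1 R)).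
  have -> : (q w - a + e) / (2 * e) + 2^-1 - 1 = (q w - a) / (2 * e) by field; lra.
  move=> /int_num_eq0 qw; apply: (in_simplex_ext KA qA pA wA); apply/eqP.
  have e2 : 0 < 2 * e by lra.
  rewrite -subr_eq0 -/a; have /eqP : (q w - a) / (2 * e) = 0.
    by apply: qw; rewrite normrM [X in _ * X]gtr0_norm ?invr_gt0// ltr_pdivrMr//; lra.
  by rewrite mulf_eq0 invr_eq0 (gt_eqF e2) orbF.
pose C := im_geod x z `|` im_geod x y `|` im_geod y z.
have cC : compact C by apply: compactU; [apply: compactU|]; exact: compact_im_geod.
have [h hc hP] := contractible_lift treeK phic cC.
have along x' y' : im_geod x' y' `<=` C ->
    {within `[0, path_dist x' y'], continuous (h \o geod x' y')}.
  move=> sub; apply: within_continuous_along hc.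
    exact: (isometric_continuous lfK conK (geod_isometric conK x' y')).
  by move=> s sd; apply: sub; exists s.
(* Where [h + 1/2] is an integer, [phi] is 1/2 modulo 1 and the point is [p]; a geodesic avoiding
   [p] thus keeps the floor constant. *)
have avoid x' y' : im_geod x' y' `<=` C -> ~ im_geod x' y' p ->
    Num.floor (h x' + 2^-1) = Num.floor (h y' + 2^-1).
  move=> sub nop; have [g0 gd _] := geod_isometric conK x' y'.
  rewrite -{1}g0 -{2}gd.
  apply: (@floor_IVT _ (fun s => h (geod x' y' s) + 2^-1)); first exact: path_dist_ge0.
    exact: within_continuousD (along _ _ sub) (@within_continuous_cst _ _ _ _).
  move=> s sd; apply: contra_notN nop => hZ; exists s => //.
  apply: phi_half; have /hP/rpredD/(_ hZ) : C (geod x' y' s) by apply: sub; exists s.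
  by apply: etrans; congr (_ \is a Num.int); ring.
have hu : {within `[0, D], continuous (h \o u)} by apply: along => q; left; left.
have CuP s : s \in `[0, D] -> C (u s) by move=> sD; left; left; exists s.
have t0D : t \in `[0, D] by rewrite in_itv/= !ltW.
(* At distance at least [e] from [p], [phi] is integral, so [h] is integer-valued along this
   stretch. *)
have far_const s s' : 0 <= s -> s <= s' -> s' <= D ->
    (forall r : R, s <= r <= s' -> e <= `|t - r|) -> h (u s) = h (u s').
  move=> s0 ss' s'D far.
  have sub (r : R) : r \in `[s, s'] -> r \in `[0, D].
    by rewrite !in_itv/= => /andP[sr rs']; rewrite (le_trans s0 sr) (le_trans rs' s'D).
  apply: (@int_valued_constant _ (h \o u)) => //; first exact: continuous_subspaceW hu.
  move=> r rs; have rD := sub r rs; rewrite /=.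
  have fr : phi (u r) \is a Num.int.
    by apply: phi_far; rewrite iso//; apply: far; rewrite in_itv/= in rs.
  have := rpredB fr (hP _ (CuP r rD)).
  by apply: etrans; congr (_ \is a Num.int); ring.
(* As [p] is not a vertex, [A] is the only simplex containing it, so the geodesic stays in [A]
   within [e] of [t]. *)
have local_iso s : t - e <= s <= t + e -> in_simplex A (u s) /\ `|u s w - a| = `|s - t|.
  move=> /andP[s1 s2]; have sD : s \in `[0, D] by rewrite in_itv/=; lra.
  have dps : path_dist p (u s) = `|s - t| by rewrite iso// distrC.
  have st : `|s - t| <= e by rewrite ler_norml; lra.
  have [B [KB pB usB]] : same_simplex p (u s) by apply: small; rewrite dps; lra.
  have BA : B = A.
    have [//|[v [_ _ pv]]] := two_simplices_vertex KB KA pB pA.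
    by move: pw0 pw1; rewrite /a pv vertexE; case: eqP => _ /=; rewrite ltxx.
  subst B; split=> //; rewrite -dps path_dist_same; last by exists A.
  by rewrite (segment_length_coord KA pA usB wA) distrC.
have phiE s : t - e <= s <= t + e -> phi (u s) = (u s w - a + e) / (2 * e).
  move=> st; have [usA us] := local_iso s st.
  by rewrite /phi bumpE// rampE// us ler_norml; lra.
have e2 : 0 < 2 * e by lra.
have sub (r : R) : r \in `[t - e, t + e] -> r \in `[0, D] by rewrite !in_itv/=; lra.
have lip s s' : t - e <= s <= t + e -> t - e <= s' <= t + e ->
    `|u s w - u s' w| = `|s - s'|.
  move=> st st'; have [usA _] := local_iso s st; have [us'A _] := local_iso s' st'.
  rewrite -(segment_length_coord KA usA us'A wA) -path_dist_same; last by exists A.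
  by apply: iso; apply: sub; rewrite in_itv.
(* Within [e] of [t], [phi] is continuous along [u] as a real function, so the integer-valued
   [h - phi] is constant and [h] changes exactly as [phi] does. *)
have cross : h (u (t - e)) - phi (u (t - e)) = h (u (t + e)) - phi (u (t + e)).
  apply: (@int_valued_constant _ (fun s => h (u s) - phi (u s))); first by lra.
    apply: (@within_continuousD _ _ _ (h \o u) (fun s => - phi (u s))).
      exact: continuous_subspaceW hu.
    apply: (@within_continuous_lipschitz _ _ _ (2 * e)^-1); first by rewrite invr_gt0.
    move=> s s'; rewrite !in_itv/= => st st'.
    rewrite opprK addrC distrC !phiE// -mulrBl normrM mulrC.
    rewrite [X in X * _]gtr0_norm ?invr_gt0// -(lip s s')//.
    by rewrite [X in `|X|](_ : _ = u s w - u s' w)//; ring.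
  move=> s st; have := hP _ (CuP s (sub s st)); rewrite -rpredN.
  by apply: etrans; congr (_ \is a Num.int); ring.
have hx : h x = h (u (t - e)).
  rewrite -u0; apply: far_const; rewrite ?lexx//; try lra.
  by move=> r rt; rewrite ler_normr; apply/orP; left; lra.
have hz : h (u (t + e)) = h z.
  rewrite -uD; apply: far_const; rewrite ?lexx//; try lra.
  by move=> r rt; rewrite ler_normr; apply/orP; right; lra.
have fl : Num.floor (h x + 2^-1) = Num.floor (h z + 2^-1).
  rewrite (avoid x y) ?(avoid y z)//; first by move=> q; right.
  by move=> q; left; right.
have st1 : t - e <= t - e <= t + e by lra.
have st2 : t - e <= t + e <= t + e by lra.
have := lip _ _ st1 st2; have [_] := local_iso _ st1; have [_] := local_iso _ st2.
rewrite (phiE _ st1) (phiE _ st2) hz -hx in cross.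
have no_step (r : R) : Num.floor (r + 1 + 2^-1) = Num.floor (r + 2^-1) -> False.
  by rewrite addrAC floorDrz ?int_num1// floor1 => /eqP; rewrite -subr_eq0 addrAC subrr add0r.
move: (u (t - e) w) (u (t + e) w) cross => b1 b2 cross.
rewrite (_ : t + e - t = e); last by ring.
rewrite (_ : t - e - t = - e); last by ring.
rewrite (_ : t - e - (t + e) = - (2 * e)); last by ring.
rewrite !normrN (gtr0_norm e0) (gtr0_norm e2) => b2e b1e b12.
have e2_n0 : 2 * e != 0 by rewrite gt_eqF.
(* Both coordinates are [e] away from [a] and [2 * e] apart, so they lie on opposite sides; the
   cases are the two directions of travel. *)
have [[b1E b2E]|[b1E b2E]] : (b1 = a - e /\ b2 = a + e) \/ (b1 = a + e /\ b2 = a - e).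
  move: b1e b2e b12; case: (ltrgt0P (b1 - a)) => ?; case: (ltrgt0P (b2 - a)) => ?;
  case: (ltrgt0P (b1 - b2)) => ? *; ((left; lra) || (right; lra)).
- apply: (no_step (h x)); rewrite fl; congr (Num.floor (_ + _)); move: cross.
  rewrite b1E b2E (_ : a - e - a + e = 0); last by ring.
  by rewrite (_ : a + e - a + e = 2 * e) ?divff//; [lra|ring].
- apply: (no_step (h z)); rewrite -fl; congr (Num.floor (_ + _)); move: cross.
  rewrite b1E b2E (_ : a - e - a + e = 0); last by ring.
  by rewrite (_ : a + e - a + e = 2 * e) ?divff//; [lra|ring].
Qed.

Lemma im_geod_triple x y z : im_geod x z `<=` im_geod x y `|` im_geod y z.
Proof.
move=> p xzp; apply: contrapT => /not_orP[xyp yzp].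
have [t] := xzp; rewrite /= in_itv/= => /andP[t0 tD] up.
have [u0 uD iso] := geod_isometric conK x z.
(* At an end of the geodesic, [p] is [x] or [z], an end of one of the other two geodesics. *)
have t_gt0 : 0 < t.
  rewrite lt0r t0 andbT; apply: contra_notN xyp => /eqP tt0; exists 0.
    by rewrite /= in_itv/= lexx path_dist_ge0.
  by have [-> _ _] := geod_isometric conK x y; rewrite -u0 -tt0.
have t_ltD : t < path_dist x z.
  rewrite lt_neqAle tD andbT; apply: contra_notN yzp => /eqP ttD.
  exists (path_dist y z); first by rewrite /= in_itv/= lexx path_dist_ge0.
  by have [_ -> _] := geod_isometric conK y z; rewrite -uD -ttD.
have [[w [pw0 pw1]]|vert] := pselect (exists w, 0 < p w /\ p w < 1).
  have := @geod_separates x y z t w t_gt0 t_ltD; rewrite up.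
  by move=> /(_ pw0 pw1)[].
have [v pv] : exists v, p v = 1.
  have [A KA pA] := simplex_exists p; have [v _ pv] := bary_support KA pA.
  exists v; apply/eqP; rewrite eq_le bary_le1 leNgt; apply/negP => pv1.
  by apply: vert; exists v.
have [d1 d10 d1P] := im_geod_far xyp; have [d2 d20 d2P] := im_geod_far yzp.
(* Moving on by [m < 1] from the vertex [p] reaches an interior point of an edge, still off the
   other two geodesics as [m] is below both distances. *)
have [m [m0 m1 mD [md1 md2]]] : exists m : R, [/\ 0 < m, m < 1, t + m < path_dist x z &
    m < d1 /\ m < d2].
  exists (Num.min 1 (Num.min (path_dist x z - t) (Num.min d1 d2)) / 2).
  set m := Num.min _ _; have : m <= m by [].
  rewrite {2}/m !le_min => /andP[m1 /andP[m2 /andP[m3 m4]]].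
  have m0 : 0 < m by rewrite /m !lt_min ltr01 subr_gt0 t_ltD d10.
  by split; [lra|lra|lra|split; lra].
pose q := geod x z (t + m).
have pq : path_dist p q = m.
  rewrite -up iso ?in_itv/=; [|lra|lra].
  by rewrite (_ : t - (t + m) = - m) ?normrN ?gtr0_norm//; ring.
(* The coordinates of a vertex are 0 or 1, so the radius 1 is admissible here. *)
have [B [KB pB qB]] : same_simplex p q.
  apply: (path_dist_lt_same conK (lexx 1)); last by rewrite pq.
  move=> v'; rewrite (eq_vertex pv) vertexE; case: eqP => _ /=; rewrite ?mulr1n ?mulr0n; lra.
have vB : v \in B by apply: bary_gt0_mem pB _; rewrite pv.
have qv : q v = 1 - m.
  have := @path_dist_vertex _ _ _ q v; rewrite -(eq_vertex pv) path_distC pq.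
  by move=> ->; [ring|exists B].
have [] := @geod_separates x y z (t + m) v; rewrite -/q ?qv; try lra.
- by move=> /d1P; rewrite pq; lra.
- by move=> /d2P; rewrite pq; lra.
Qed.

End Tree.

Theorem lemma8p5 (R : realType) (V : choiceType) (K : simplicial1 V)
    (treeK : geometric_tree R K) (lfK : locally_finite K)
    (n : nat) (n_ge2 : (2 <= n)%N) (x : nat -> realization R K) :
  im_geod (x 1%N) (x n) `<=`
    \bigcup_(i in [set i : nat | (1 <= i < n)%N]) im_geod (x i) (x i.+1).
Proof.
(* The number of points is now [n.+2]; for two points the only index is 1. *)
case: n n_ge2 => [//|[//|n _]]; elim: n => [|n IH] p; first by exists 1.
(* The intermediate point is the last but one of the [n.+3] points. *)
move=> /(@im_geod_triple _ _ _ treeK lfK _ (x n.+2))[/IH[i /andP[i1 i2] ip]|np].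
  by exists i => //=; rewrite i1 ltnW.
by exists n.+2 => //=; rewrite ltnSn.
Qed.
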